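(* Let $\mathcal{C}$ be a cartesian monoidal category. There is a symmetric monoidal category $\mathbf{TL}[\mathcal{C}]$ whose objects are the objects of $\mathcal{C}$, whose morphisms from $S$ to $S'$ are the tagged vwb-lenses from $S$ to $S'$, whose sequential composition of $(p_1,g_1,T_1):V\to V'$ and $(p_2,g_2,T_2):V'\to V''$ is the triple $(p,g,T):V\to V''$ given by $$p(s,v)=p_2\big(s,\,p_1(g_2(s),v)\big),\qquad g(s)=g_1(g_2(s)),$$ $$T(s,v_1,v_2)=p_2\big(s',\,T_1(g_2(s'),v_1,v_2)\big),\quad\text{where } s'=T_2\Big(s,\;p_1(g_2(s),v_1),\;p_1\big(T_1(g_2(s),v_1,v_2),\,v_2\big)\Big),$$ and whose parallel composition of $(p_1,g_1,T_1):V\to V'$ and $(p_2,g_2,T_2):W\to W'$ is the triple $(p,g,T):V\times W\to V'\times W'$ given by $$p((s,t),(v,w))=(p_1(s,v),p_2(t,w)),\qquad g(s,t)=(g_1(s),g_2(t)),$$ $$T\big((s,t),(v_1,w_1),(v_2,w_2)\big)=(T_1(s,v_1,v_2),\,T_2(t,w_1,w_2)).$$ If moreover $\mathcal{C}$ is strict as a monoidal category, then $\mathbf{TL}[\mathcal{C}]$ is a strict symmetric monoidal category.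
   Context: Let $\mathcal{C}$ be a cartesian monoidal category (monoidal product $\otimes=\times$ the categorical product, unit $I$ terminal). Equations between morphisms are written with generalized elements (variables), as is standard in a category with finite products. A lens from $V$ to $S$ is a pair of morphisms $(p,g)$ with $p : S\times V\to S$ and $g : S\to V$. It is very-well-behaved (vwb) if it satisfies putput: $p(p(s,v_1),v_2)=p(s,v_2)$; putget: $g(p(s,v))=v$; getput: $p(s,g(s))=s$. A tagged vwb-lens from $V$ to $S$ is a triple $(p,g,T)$ where $(p,g)$ is a vwb-lens from $V$ to $S$ and $T : S\times V\times V\to S$ is a morphism such that $p(T(s,v_1,v_2),v_3)=T(p(s,v_3),v_1,v_2)$ and $g(T(s,v_1,v_2))=g(s)$. The identity tagged lens on $V$ is $p(v,v')=v'$, $g(v)=v$, $T(v,v',v'')=v$. The monoidal unit is the unit $I$ of $\mathcal{C}$. The structural isomorphisms (braiding, and associators and unitors when $\mathcal{C}$ is not strict) are those induced from $\mathcal{C}$: a structural isomorphism $f:A\to B$ of $\mathcal{C}$ gives the tagged lens from $A$ to $B$ with $g=f^{-1}$, $p(b,a)=f(a)$, $T(b,a_1,a_2)=b$. In particular, ''strict'' means associators and unitors are identities. *)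

(* Defs.v *)
(* No category theory is taken from a library; only the ssreflect language
   of MathComp is used. *)
From mathcomp Require Import ssreflect.

Set Implicit Arguments.
Unset Strict Implicit.
Unset Printing Implicit Defensive.

Declare Scope cat_scope.
Delimit Scope cat_scope with cat.
Local Open Scope cat_scope.

(* Objects and morphisms are parameters, so that one can speak of a category
   with prescribed objects and morphisms.  Composition is in diagrammatic
   order, and equality of morphisms is Leibniz equality. *)
Record category_on (Ob : Type) (Hom : Ob -> Ob -> Type) := CategoryOn {
  idm_on : forall A, Hom A A;
  comp_on : forall A B D, Hom A B -> Hom B D -> Hom A D;
  comp_id_l_on : forall A B (f : Hom A B), comp_on (idm_on A) f = f;
  comp_id_r_on : forall A B (f : Hom A B), comp_on f (idm_on B) = f;
  comp_assoc_on : forall A B D E (f : Hom A B) (g : Hom B D) (h : Hom D E),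
    comp_on (comp_on f g) h = comp_on f (comp_on g h)
}.

Record category := Category {
  obj :> Type;
  hom : obj -> obj -> Type;
  cat_on : category_on hom
}.

Arguments hom {_} _ _.

Definition idm (C : category) (A : C) : hom A A := idm_on (cat_on C) A.

Definition comp (C : category) (A B D : C) (f : hom A B) (g : hom B D) :
    hom A D :=
  comp_on (cat_on C) f g.

Arguments idm {C} A.

Notation "f ;; g" := (comp f g)
  (at level 45, right associativity) : cat_scope.

Section CategoryLemmas.
Variables (C : category).

Lemma comp_id_l (A B : C) (f : hom A B) : idm A ;; f = f.
Proof. exact: comp_id_l_on. Qed.

Lemma comp_id_r (A B : C) (f : hom A B) : f ;; idm B = f.
Proof. exact: comp_id_r_on. Qed.

Lemma comp_assoc (A B D E : C) (f : hom A B) (g : hom B D) (h : hom D E) :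
  (f ;; g) ;; h = f ;; (g ;; h).
Proof. exact: comp_assoc_on. Qed.

End CategoryLemmas.

Record iso (C : category) (A B : C) := Iso {
  fwd : hom A B;
  bwd : hom B A;
  fwd_bwd : fwd ;; bwd = idm A;
  bwd_fwd : bwd ;; fwd = idm B
}.

Definition idtohom (C : category) (A B : C) (e : A = B) : hom A B :=
  match e in _ = X return hom A X with eq_refl => idm A end.

Record symmetric_monoidal (C : category) (tensor : C -> C -> C) (unit : C) :=
  SymmetricMonoidal {
  tensor_hom : forall A A' B B' : C,
    hom A A' -> hom B B' -> hom (tensor A B) (tensor A' B');
  associator : forall A B D : C,
    iso (tensor (tensor A B) D) (tensor A (tensor B D));
  left_unitor : forall A : C, iso (tensor unit A) A;
  right_unitor : forall A : C, iso (tensor A unit) A;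
  braiding : forall A B : C, iso (tensor A B) (tensor B A);

  tensor_id : forall A B : C,
    tensor_hom (idm A) (idm B) = idm (tensor A B);
  tensor_comp : forall (A A' A'' B B' B'' : C) (f : hom A A')
      (f' : hom A' A'') (g : hom B B') (g' : hom B' B''),
    tensor_hom (f ;; f') (g ;; g') = tensor_hom f g ;; tensor_hom f' g';

  associator_natural : forall (A A' B B' D D' : C) (f : hom A A')
      (g : hom B B') (h : hom D D'),
    tensor_hom (tensor_hom f g) h ;; fwd (associator A' B' D')
    = fwd (associator A B D) ;; tensor_hom f (tensor_hom g h);
  left_unitor_natural : forall (A A' : C) (f : hom A A'),
    tensor_hom (idm unit) f ;; fwd (left_unitor A')
    = fwd (left_unitor A) ;; f;
  right_unitor_natural : forall (A A' : C) (f : hom A A'),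
    tensor_hom f (idm unit) ;; fwd (right_unitor A')
    = fwd (right_unitor A) ;; f;
  braiding_natural : forall (A A' B B' : C) (f : hom A A') (g : hom B B'),
    tensor_hom f g ;; fwd (braiding A' B')
    = fwd (braiding A B) ;; tensor_hom g f;

  pentagon : forall A B D E : C,
    fwd (associator (tensor A B) D E) ;; fwd (associator A B (tensor D E))
    = tensor_hom (fwd (associator A B D)) (idm E)
      ;; fwd (associator A (tensor B D) E)
      ;; tensor_hom (idm A) (fwd (associator B D E));
  triangle : forall A B : C,
    fwd (associator A unit B) ;; tensor_hom (idm A) (fwd (left_unitor B))
    = tensor_hom (fwd (right_unitor A)) (idm B);
  hexagon : forall A B D : C,
    fwd (associator A B D) ;; fwd (braiding A (tensor B D))
      ;; fwd (associator B D A)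
    = tensor_hom (fwd (braiding A B)) (idm D)
      ;; fwd (associator B A D)
      ;; tensor_hom (idm B) (fwd (braiding A D));
  symmetry : forall A B : C,
    fwd (braiding A B) ;; fwd (braiding B A) = idm (tensor A B)
}.

(* "The associators and unitors are identities" presupposes equalities between
   their sources and targets, whence the transported identities [idtohom]. *)
Definition strict (C : category) (tensor : C -> C -> C) (unit : C)
    (M : symmetric_monoidal tensor unit) : Prop :=
  (exists e : forall A B D, tensor (tensor A B) D = tensor A (tensor B D),
    forall A B D, fwd (associator M A B D) = idtohom (e A B D))
  /\ (exists e : forall A, tensor unit A = A,
    forall A, fwd (left_unitor M A) = idtohom (e A))
  /\ (exists e : forall A, tensor A unit = A,
    forall A, fwd (right_unitor M A) = idtohom (e A)).

(* A category with chosen binary products and a chosen terminal object; the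
   symmetric monoidal structure this induces is [cartesian_structure]. *)
Record cartesian_monoidal := CartesianMonoidal {
  cart_cat :> category;
  prod : cart_cat -> cart_cat -> cart_cat;
  fst : forall A B, hom (prod A B) A;
  snd : forall A B, hom (prod A B) B;
  pair : forall X A B, hom X A -> hom X B -> hom X (prod A B);
  pair_fst : forall X A B (f : hom X A) (g : hom X B), pair f g ;; fst A B = f;
  pair_snd : forall X A B (f : hom X A) (g : hom X B), pair f g ;; snd A B = g;
  pair_unique : forall X A B (f : hom X A) (g : hom X B)
      (h : hom X (prod A B)),
    h ;; fst A B = f -> h ;; snd A B = g -> h = pair f g;
  one : cart_cat;
  to_one : forall X, hom X one;
  to_one_unique : forall X (h : hom X one), h = to_one X
}.

Arguments prod {_} _ _.
Arguments fst {_ _ _}.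
Arguments snd {_ _ _}.
Arguments one {_}.
Arguments to_one {_} X.

Notation "A × B" := (prod A B) (at level 40, left associativity) : cat_scope.
Notation "⟨ f , g ⟩" := (pair f g) (at level 0, format "⟨ f ,  g ⟩") : cat_scope.

Section CartesianStructure.
Variables (C : cartesian_monoidal).

Lemma comp_pair (X Y A B : C) (h : hom Y X) (f : hom X A) (g : hom X B) :
  h ;; ⟨f, g⟩ = ⟨h ;; f, h ;; g⟩.
Proof.
by apply: pair_unique; rewrite comp_assoc ?pair_fst ?pair_snd.
Qed.

Lemma pair_eta (X A B : C) (h : hom X (A × B)) : ⟨h ;; fst, h ;; snd⟩ = h.
Proof. by symmetry; apply: pair_unique. Qed.

Lemma pair_fst_snd (A B : C) : ⟨fst, snd⟩ = idm (A × B).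
Proof. by symmetry; apply: pair_unique; rewrite comp_id_l. Qed.

Lemma comp_pair_fst (X A B D : C) (f : hom X A) (g : hom X B) (h : hom A D) :
  ⟨f, g⟩ ;; fst ;; h = f ;; h.
Proof. by rewrite -comp_assoc pair_fst. Qed.

Lemma comp_pair_snd (X A B D : C) (f : hom X A) (g : hom X B) (h : hom B D) :
  ⟨f, g⟩ ;; snd ;; h = g ;; h.
Proof. by rewrite -comp_assoc pair_snd. Qed.

Lemma to_one_eq (X : C) (f g : hom X one) : f = g.
Proof. by rewrite (to_one_unique f) (to_one_unique g). Qed.

Let cartE := (comp_assoc, comp_pair, pair_fst, pair_snd, comp_pair_fst,
  comp_pair_snd, comp_id_l, comp_id_r, pair_eta, pair_fst_snd).

Definition prod_hom (A A' B B' : C) (f : hom A A') (g : hom B B') :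
    hom (A × B) (A' × B') :=
  ⟨fst ;; f, snd ;; g⟩.

Definition prod_assoc (A B D : C) : iso (A × B × D) (A × (B × D)).
Proof.
apply: (@Iso C _ _ ⟨fst ;; fst, ⟨fst ;; snd, snd⟩⟩
                   ⟨⟨fst, snd ;; fst⟩, snd ;; snd⟩); by rewrite !cartE.
Defined.

Definition prod_lunit (A : C) : iso (one × A) A.
Proof.
apply: (@Iso C _ _ snd ⟨to_one A, idm A⟩); rewrite !cartE //.
by rewrite (to_one_eq (snd ;; to_one A) fst) cartE.
Defined.

Definition prod_runit (A : C) : iso (A × one) A.
Proof.
apply: (@Iso C _ _ fst ⟨idm A, to_one A⟩); rewrite !cartE //.
by rewrite (to_one_eq (fst ;; to_one A) snd) cartE.
Defined.

Definition prod_braid (A B : C) : iso (A × B) (B × A).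
Proof.
by apply: (@Iso C _ _ ⟨snd, fst⟩ ⟨snd, fst⟩); rewrite !cartE.
Defined.

Definition cartesian_structure : symmetric_monoidal (@prod C) one.
Proof.
apply: (@SymmetricMonoidal C (@prod C) one
  prod_hom prod_assoc prod_lunit prod_runit prod_braid);
  move=> *; by rewrite /prod_hom /= !cartE.
Defined.

End CartesianStructure.

Section TaggedLenses.
Variables (C : cartesian_monoidal).

(* The data of a tagged lens from V to S; S × V × V is (S × V) × V. *)
Record lens_triple (V S : C) := LensTriple {
  put : hom (S × V) S;
  get : hom S V;
  tag : hom (S × V × V) S
}.

(* Morphisms X -> S and X -> V play the role of generalized elements s and v;
   ap_put l s v is p(s,v), and similarly for g and T. *)
Definition ap_put (V S : C) (l : lens_triple V S) (X : C)
    (s : hom X S) (v : hom X V) : hom X S :=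
  ⟨s, v⟩ ;; put l.

Definition ap_get (V S : C) (l : lens_triple V S) (X : C)
    (s : hom X S) : hom X V :=
  s ;; get l.

Definition ap_tag (V S : C) (l : lens_triple V S) (X : C)
    (s : hom X S) (v1 v2 : hom X V) : hom X S :=
  ⟨⟨s, v1⟩, v2⟩ ;; tag l.

Record is_vwb (V S : C) (l : lens_triple V S) : Prop := {
  putput : forall (X : C) (s : hom X S) (v1 v2 : hom X V),
    ap_put l (ap_put l s v1) v2 = ap_put l s v2;
  putget : forall (X : C) (s : hom X S) (v : hom X V),
    ap_get l (ap_put l s v) = v;
  getput : forall (X : C) (s : hom X S),
    ap_put l s (ap_get l s) = s
}.

Record tagged_lens (V S : C) := TaggedLens {
  triple : lens_triple V S;
  triple_vwb : is_vwb triple;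
  put_tag : forall (X : C) (s : hom X S) (v1 v2 v3 : hom X V),
    ap_put triple (ap_tag triple s v1 v2) v3
    = ap_tag triple (ap_put triple s v3) v1 v2;
  get_tag : forall (X : C) (s : hom X S) (v1 v2 : hom X V),
    ap_get triple (ap_tag triple s v1 v2) = ap_get triple s
}.

(* In the next definitions the variables of the defining formulas are the
   projections out of the domain (for g, the identity). *)
Definition id_triple (V : C) : lens_triple V V :=
  {| put := snd; get := idm V; tag := fst ;; fst |}.

Definition comp_triple (V V' V'' : C)
    (l1 : lens_triple V V') (l2 : lens_triple V' V'') : lens_triple V V'' :=
  {| put :=
       let s := fst in let v := snd in
       ap_put l2 s (ap_put l1 (ap_get l2 s) v);
     get :=
       let s := idm V'' in
       ap_get l1 (ap_get l2 s);
     tag :=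
       let s := fst ;; fst in let v1 := fst ;; snd in let v2 := snd in
       let s' :=
         ap_tag l2 s (ap_put l1 (ap_get l2 s) v1)
                     (ap_put l1 (ap_tag l1 (ap_get l2 s) v1 v2) v2) in
       ap_put l2 s' (ap_tag l1 (ap_get l2 s') v1 v2) |}.

Definition tensor_triple (V V' W W' : C)
    (l1 : lens_triple V V') (l2 : lens_triple W W') :
    lens_triple (V × W) (V' × W') :=
  {| put :=
       let s := fst ;; fst in let t := fst ;; snd in
       let v := snd ;; fst in let w := snd ;; snd in
       ⟨ap_put l1 s v, ap_put l2 t w⟩;
     get :=
       let s := fst in let t := snd in
       ⟨ap_get l1 s, ap_get l2 t⟩;
     tag :=
       let s := fst ;; fst ;; fst in let t := fst ;; fst ;; snd in
       let v1 := fst ;; snd ;; fst in let w1 := fst ;; snd ;; snd in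
       let v2 := snd ;; fst in let w2 := snd ;; snd in
       ⟨ap_tag l1 s v1 v2, ap_tag l2 t w1 w2⟩ |}.

(* g = f^-1, p(b,a) = f(a), T(b,a1,a2) = b. *)
Definition iso_triple (A B : C) (f : iso A B) : lens_triple A B :=
  {| put := snd ;; fwd f; get := bwd f; tag := fst ;; fst |}.

End TaggedLenses.

(* Main.v *)
Require Import Defs.
From mathcomp Require Import ssreflect.
From Stdlib Require Import ProofIrrelevance.

Set Implicit Arguments.
Unset Strict Implicit.
Unset Printing Implicit Defensive.

Local Open Scope cat_scope.

(** Working with generalized elements, a very-well-behaved lens from V to S
    behaves like an isomorphism of S with K × V, where the complement K is left
    unchanged by put.  The two axioms on the tag say that tag fixes the
    V-component and that its effect on the complement does not depend on it, so
    a tag amounts to a family of operations T_(v1,v2) : K -> K.  Composing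
    S'' ~ K2 × V' with V' ~ K1 × V gives the complement K2 × K1, on which the
    composite tag acts by
<<
      (k2, k1) |-> (T2_((k1,v1), (T1_(v1,v2) k1, v2)) k2, T1_(v1,v2) k1):
>>
    the transition v1 -> v2 is lifted by T1 to a transition of V', which T2
    consumes.  Lifting twice is lifting along the composite, which is
    associativity; the other laws are of the same kind.

    The complement need not exist as an object of the category C, so the computation is done
    by rewriting in the equational theory of lenses.  The rules [lensE] push put
    outside tag and remove every put or tag under a get; together with the rules
    [cartE] for tuples they bring both sides of each law to a common form.
    By [tagged_lens_ext] it suffices to compare the three operations on
    generalized elements.

    The coherence laws require no computation with tags: f |-> [iso_lens f] is
    functorial ([iso_lens_comp]) and compatible with products
    ([tensor_iso_lens]), and depends only on the forward morphism
    ([iso_lens_ext]), so the pentagon, triangle, hexagon and symmetry are images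
    of those of C.  Likewise an isomorphism of C which is a transported identity
    induces a lens which is a transported identity ([idtohom_lens]), and
    strictness passes from C to lenses. *)

(** * Generalized elements *)

Section Elements.
Variables (C : cartesian_monoidal).

Definition cartE := (comp_assoc, comp_pair, pair_fst, pair_snd, comp_pair_fst,
  comp_pair_snd, comp_id_l, comp_id_r, pair_eta, pair_fst_snd).

Lemma comp_ap_put (V S : C) (l : lens_triple V S) (X Y : C) (h : hom Y X)
    (s : hom X S) (v : hom X V) :
  h ;; ap_put l s v = ap_put l (h ;; s) (h ;; v).
Proof. by rewrite /ap_put -comp_assoc !comp_pair. Qed.

Lemma comp_ap_get (V S : C) (l : lens_triple V S) (X Y : C) (h : hom Y X)
    (s : hom X S) :
  h ;; ap_get l s = ap_get l (h ;; s).
Proof. by rewrite /ap_get comp_assoc. Qed.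

Lemma comp_ap_tag (V S : C) (l : lens_triple V S) (X Y : C) (h : hom Y X)
    (s : hom X S) (v1 v2 : hom X V) :
  h ;; ap_tag l s v1 v2 = ap_tag l (h ;; s) (h ;; v1) (h ;; v2).
Proof. by rewrite /ap_tag -comp_assoc !comp_pair. Qed.

Definition elemE := (comp_ap_put, comp_ap_get, comp_ap_tag, cartE).

(** The Yoneda lemma: each component of a triple is its own value at the
    generic element given by the projections. *)
Lemma lens_triple_ext (V S : C) (l l' : lens_triple V S) :
  (forall X (s : hom X S) v, ap_put l s v = ap_put l' s v) ->
  (forall X (s : hom X S), ap_get l s = ap_get l' s) ->
  (forall X (s : hom X S) v1 v2, ap_tag l s v1 v2 = ap_tag l' s v1 v2) ->
  l = l'.
Proof.
case: l l' => [p g T] [p' g' T'] eq_p eq_g eq_T.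
move: (eq_p _ fst snd) (eq_g _ (idm S)) (eq_T _ (fst ;; fst) (fst ;; snd) snd).
by rewrite /ap_put /ap_get /ap_tag /= !cartE => -> -> ->.
Qed.

Lemma triple_inj (V S : C) (l l' : tagged_lens V S) :
  triple l = triple l' -> l = l'.
Proof.
case: l l' => [t H1 H2 H3] [t' H1' H2' H3'] /= E.
by case: _ / E H1' H2' H3' => *; congr TaggedLens; apply: proof_irrelevance.
Qed.

Lemma tagged_lens_ext (V S : C) (l l' : tagged_lens V S) :
  (forall X (s : hom X S) v,
    ap_put (triple l) s v = ap_put (triple l') s v) ->
  (forall X (s : hom X S), ap_get (triple l) s = ap_get (triple l') s) ->
  (forall X (s : hom X S) v1 v2,
    ap_tag (triple l) s v1 v2 = ap_tag (triple l') s v1 v2) ->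
  l = l'.
Proof. by move=> *; apply/triple_inj/lens_triple_ext. Qed.

End Elements.

(** * Rewriting rules for tagged lenses *)

Section Rules.
Variables (C : cartesian_monoidal) (V S : C) (l : tagged_lens V S).
Local Notation t := (triple l).
Variables (X : C) (s : hom X S).

Lemma lens_putput v1 v2 : ap_put t (ap_put t s v1) v2 = ap_put t s v2.
Proof. exact: (putput (triple_vwb l)). Qed.

Lemma lens_putget v : ap_get t (ap_put t s v) = v.
Proof. exact: (putget (triple_vwb l)). Qed.

Lemma lens_getput : ap_put t s (ap_get t s) = s.
Proof. exact: (getput (triple_vwb l)). Qed.

Lemma lens_get_tag v1 v2 : ap_get t (ap_tag t s v1 v2) = ap_get t s.
Proof. exact: get_tag. Qed.

Lemma lens_tag_put v1 v2 v3 :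
  ap_tag t (ap_put t s v3) v1 v2 = ap_put t (ap_tag t s v1 v2) v3.
Proof. by rewrite put_tag. Qed.

(** Completes the rules: once get of a tag is rewritten to get of its argument,
    the getput law no longer matches on a tag. *)
Lemma lens_put_tag_get v1 v2 :
  ap_put t (ap_tag t s v1 v2) (ap_get t s) = ap_tag t s v1 v2.
Proof. by rewrite -(lens_get_tag v1 v2) (getput (triple_vwb l)). Qed.

End Rules.

Definition lensE := (lens_putput, lens_putget, lens_getput, lens_get_tag,
  lens_tag_put, lens_put_tag_get).

(** * Identity, composition and product of tagged lenses *)

Section Operations.
Variables (C : cartesian_monoidal).

Section Iso.
Variables (A B : C) (f : iso A B) (X : C).

Lemma ap_put_iso (b : hom X B) (a : hom X A) :
  ap_put (iso_triple f) b a = a ;; fwd f.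
Proof. by rewrite /ap_put /= !cartE. Qed.

Lemma ap_get_iso (b : hom X B) : ap_get (iso_triple f) b = b ;; bwd f.
Proof. by []. Qed.

Lemma ap_tag_iso (b : hom X B) (a1 a2 : hom X A) :
  ap_tag (iso_triple f) b a1 a2 = b.
Proof. by rewrite /ap_tag /= !cartE. Qed.

End Iso.

Definition isoE := (ap_put_iso, ap_get_iso, ap_tag_iso).

Definition iso_lens (A B : C) (f : iso A B) : tagged_lens A B.
Proof.
by exists (iso_triple f); first split; move=> *;
  rewrite !isoE ?comp_assoc ?fwd_bwd ?bwd_fwd ?comp_id_r.
Defined.

(** Seeing the identity lens as induced by an isomorphism puts the identities
    occurring in the coherence laws within reach of [iso_lens_ext]. *)
Definition id_iso (A : C) : iso A A :=
  Iso (comp_id_l (idm A)) (comp_id_l (idm A)).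

Lemma iso_triple_id (A : C) : iso_triple (id_iso A) = id_triple A.
Proof. by rewrite /iso_triple /= comp_id_r. Qed.

Definition id_lens (A : C) : tagged_lens A A := iso_lens (id_iso A).

Section Comp.
Variables (A B D : C).

Section Triple.
Variables (l1 : lens_triple A B) (l2 : lens_triple B D) (X : C) (s : hom X D).

Lemma ap_put_comp v :
  ap_put (comp_triple l1 l2) s v = ap_put l2 s (ap_put l1 (ap_get l2 s) v).
Proof. by rewrite [LHS]/ap_put /= !elemE. Qed.

Lemma ap_get_comp : ap_get (comp_triple l1 l2) s = ap_get l1 (ap_get l2 s).
Proof. by rewrite [LHS]/ap_get /= !elemE. Qed.

Lemma ap_tag_comp v1 v2 :
  let s' := ap_tag l2 s (ap_put l1 (ap_get l2 s) v1)
                        (ap_put l1 (ap_tag l1 (ap_get l2 s) v1 v2) v2) in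
  ap_tag (comp_triple l1 l2) s v1 v2
  = ap_put l2 s' (ap_tag l1 (ap_get l2 s') v1 v2).
Proof. by move=> *; rewrite [LHS]/ap_tag /= !elemE. Qed.

End Triple.

Definition compE := (ap_put_comp, ap_get_comp, ap_tag_comp).

Definition comp_lens (l1 : tagged_lens A B) (l2 : tagged_lens B D) :
  tagged_lens A D.
Proof.
by exists (comp_triple (triple l1) (triple l2)); first split; move=> *;
  rewrite !compE !lensE.
Defined.

End Comp.

Section Tensor.
Variables (A A' B B' : C).

Section Triple.
Variables (l1 : lens_triple A A') (l2 : lens_triple B B').
Variables (X : C) (s : hom X (A' × B')).

Lemma ap_put_tensor v :
  ap_put (tensor_triple l1 l2) s v
  = ⟨ap_put l1 (s ;; fst) (v ;; fst), ap_put l2 (s ;; snd) (v ;; snd)⟩.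
Proof. by rewrite [LHS]/ap_put /= !elemE. Qed.

Lemma ap_get_tensor :
  ap_get (tensor_triple l1 l2) s
  = ⟨ap_get l1 (s ;; fst), ap_get l2 (s ;; snd)⟩.
Proof. by rewrite [LHS]/ap_get /= !elemE. Qed.

Lemma ap_tag_tensor v1 v2 :
  ap_tag (tensor_triple l1 l2) s v1 v2
  = ⟨ap_tag l1 (s ;; fst) (v1 ;; fst) (v2 ;; fst),
     ap_tag l2 (s ;; snd) (v1 ;; snd) (v2 ;; snd)⟩.
Proof. by move=> *; rewrite [LHS]/ap_tag /= !elemE. Qed.

End Triple.

Definition tensorE := (ap_put_tensor, ap_get_tensor, ap_tag_tensor).

Definition tensor_lens (l1 : tagged_lens A A') (l2 : tagged_lens B B') :
  tagged_lens (A × B) (A' × B').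
Proof.
by exists (tensor_triple (triple l1) (triple l2)); first split; move=> *;
  rewrite !tensorE !cartE !lensE ?cartE.
Defined.

End Tensor.

(** * The category of tagged lenses *)

Lemma comp_lens_idl (A B : C) (l : tagged_lens A B) :
  comp_lens (id_lens A) l = l.
Proof.
by apply: tagged_lens_ext => *; rewrite !compE !isoE !cartE ?lensE.
Qed.

Lemma comp_lens_idr (A B : C) (l : tagged_lens A B) :
  comp_lens l (id_lens B) = l.
Proof.
by apply: tagged_lens_ext => *; rewrite !compE !isoE !cartE.
Qed.

Lemma comp_lens_assoc (A B D E : C) (l1 : tagged_lens A B)
    (l2 : tagged_lens B D) (l3 : tagged_lens D E) :
  comp_lens (comp_lens l1 l2) l3 = comp_lens l1 (comp_lens l2 l3).
Proof.
by apply: tagged_lens_ext => *; rewrite !compE ?lensE.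
Qed.

Definition lens_category_on : category_on (@tagged_lens C) :=
  CategoryOn comp_lens_idl comp_lens_idr comp_lens_assoc.

Definition lens_category : category := Category lens_category_on.

Lemma tensor_lens_comp (A A' A'' B B' B'' : C) (l1 : tagged_lens A A')
    (l1' : tagged_lens A' A'') (l2 : tagged_lens B B')
    (l2' : tagged_lens B' B'') :
  tensor_lens (comp_lens l1 l1') (comp_lens l2 l2')
  = comp_lens (tensor_lens l1 l2) (tensor_lens l1' l2').
Proof.
(* The tuple rules come last: up to conversion they also match put, get and tag
   of a product, and would expose the components too early. *)
by apply: tagged_lens_ext => *; rewrite !(compE, tensorE) !cartE.
Qed.

(** * Lenses induced by isomorphisms *)

Definition comp_iso (A B D : C) (f : iso A B) (g : iso B D) : iso A D.
Proof.
exists (fwd f ;; fwd g) (bwd g ;; bwd f).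
- by rewrite comp_assoc -(comp_assoc (fwd g)) fwd_bwd comp_id_l fwd_bwd.
- by rewrite comp_assoc -(comp_assoc (bwd f)) bwd_fwd comp_id_l bwd_fwd.
Defined.

Definition inv_iso (A B : C) (f : iso A B) : iso B A :=
  Iso (bwd_fwd f) (fwd_bwd f).

Definition prod_iso (A A' B B' : C) (f : iso A A') (g : iso B B') :
  iso (A × B) (A' × B').
Proof.
exists (prod_hom (fwd f) (fwd g)) (prod_hom (bwd f) (bwd g));
  by rewrite /prod_hom !cartE ?fwd_bwd ?bwd_fwd !cartE.
Defined.

Lemma bwd_eq (A B : C) (f g : iso A B) : fwd f = fwd g -> bwd f = bwd g.
Proof.
move=> eq_fg.
by rewrite -(comp_id_r (bwd f)) -(fwd_bwd g) -eq_fg -comp_assoc bwd_fwd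
  comp_id_l.
Qed.

Lemma iso_lens_ext (A B : C) (f g : iso A B) :
  fwd f = fwd g -> iso_lens f = iso_lens g.
Proof.
by move=> eq_fg; apply: triple_inj; rewrite /= /iso_triple eq_fg (bwd_eq eq_fg).
Qed.

Lemma iso_lens_comp (A B D : C) (f : iso A B) (g : iso B D) :
  comp_lens (iso_lens f) (iso_lens g) = iso_lens (comp_iso f g).
Proof.
apply: tagged_lens_ext => *; rewrite !compE !isoE ?comp_assoc //.
by rewrite bwd_fwd comp_id_r.
Qed.

Lemma tensor_iso_lens (A A' B B' : C) (f : iso A A') (g : iso B B') :
  tensor_lens (iso_lens f) (iso_lens g) = iso_lens (prod_iso f g).
Proof.
by apply: tagged_lens_ext => *; rewrite !tensorE !isoE /= /prod_hom !cartE.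
Qed.

Lemma tensor_lens_id (A B : C) :
  tensor_lens (id_lens A) (id_lens B) = id_lens (A × B).
Proof.
by rewrite tensor_iso_lens; apply: iso_lens_ext; rewrite /= /prod_hom !cartE.
Qed.

Lemma iso_lens_fwd_bwd (A B : C) (f : iso A B) :
  comp_lens (iso_lens f) (iso_lens (inv_iso f)) = id_lens A.
Proof. by rewrite iso_lens_comp; apply: iso_lens_ext; rewrite /= fwd_bwd. Qed.

Lemma iso_lens_bwd_fwd (A B : C) (f : iso A B) :
  comp_lens (iso_lens (inv_iso f)) (iso_lens f) = id_lens B.
Proof. by rewrite iso_lens_comp; apply: iso_lens_ext; rewrite /= bwd_fwd. Qed.

Definition lens_iso (A B : C) (f : iso A B) : @iso lens_category A B :=
  @Iso lens_category A B _ _ (iso_lens_fwd_bwd f) (iso_lens_bwd_fwd f).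

(** As the tag of [iso_lens f] is trivial, composing with it merely transports
    the three operations along f.  This reduces naturality of a structural
    isomorphism to a computation with tuples. *)
Lemma iso_lens_square (A A' B B' : C) (l : tagged_lens A A')
    (m : tagged_lens B B') (f : iso A B) (f' : iso A' B') :
  (forall X (s : hom X B') v,
    ap_put (triple l) (s ;; bwd f') v ;; fwd f'
    = ap_put (triple m) s (v ;; fwd f)) ->
  (forall X (s : hom X B'),
    ap_get (triple l) (s ;; bwd f') = ap_get (triple m) s ;; bwd f) ->
  (forall X (s : hom X B') v1 v2,
    ap_tag (triple l) (s ;; bwd f') v1 v2 ;; fwd f'
    = ap_tag (triple m) s (v1 ;; fwd f) (v2 ;; fwd f)) ->
  comp_lens l (iso_lens f') = comp_lens (iso_lens f) m.
Proof.
move=> eq_p eq_g eq_T.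
by apply: tagged_lens_ext => *; rewrite !compE !isoE ?lensE.
Qed.

(** * The symmetric monoidal structure *)

Definition lens_symmetric_monoidal :
  @symmetric_monoidal lens_category (@prod C) one.
Proof.
pose M := cartesian_structure C.
apply: (@SymmetricMonoidal lens_category (@prod C) one tensor_lens
  (fun A B D => lens_iso (associator M A B D))
  (fun A => lens_iso (left_unitor M A))
  (fun A => lens_iso (right_unitor M A))
  (fun A B => lens_iso (braiding M A B))).
- exact: tensor_lens_id.
- exact: tensor_lens_comp.
- by move=> *; apply: iso_lens_square => *; rewrite !tensorE !cartE.
- move=> *; apply: iso_lens_square => *; rewrite !tensorE /= !cartE //.
  by congr pair; exact: to_one_eq.
- move=> *; apply: iso_lens_square => *; rewrite !tensorE /= !cartE //.
  by congr pair; exact: to_one_eq.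
- by move=> *; apply: iso_lens_square => *; rewrite !tensorE !cartE.
- move=> A B D E; rewrite /comp /idm /= !(iso_lens_comp, tensor_iso_lens).
  exact/iso_lens_ext/(pentagon M).
- move=> A B; rewrite /comp /idm /= !(iso_lens_comp, tensor_iso_lens).
  exact/iso_lens_ext/(triangle M).
- move=> A B D; rewrite /comp /idm /= !(iso_lens_comp, tensor_iso_lens).
  exact/iso_lens_ext/(hexagon M).
- move=> A B; rewrite /comp /idm /= !iso_lens_comp.
  exact/iso_lens_ext/(symmetry M).
Defined.

(** An isomorphism that is a transported identity has a transported identity as
    its lens: when the equality of objects is reflexivity, both are identities. *)
Lemma idtohom_lens (A B : C) (f : iso A B) (e : A = B) :
  fwd f = idtohom e ->
  iso_lens f = @idtohom lens_category A B e.
Proof.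
by case: B / e f => f eq_f; apply: iso_lens_ext.
Qed.

End Operations.

Theorem proposition2 (C : cartesian_monoidal) :
  exists (K : category_on (@tagged_lens C))
    (M : @symmetric_monoidal (Category K) (@prod C) (@one C)),
    (forall V : C, triple (idm_on K V) = id_triple V)
    /\ (forall (V V' V'' : C) (l1 : tagged_lens V V') (l2 : tagged_lens V' V''),
          triple (comp_on K l1 l2) = comp_triple (triple l1) (triple l2))
    /\ (forall (V V' W W' : C) (l1 : tagged_lens V V') (l2 : tagged_lens W W'),
          triple (tensor_hom M l1 l2) = tensor_triple (triple l1) (triple l2))
    /\ (forall A B D : C,
          triple (fwd (associator M A B D))
          = iso_triple (associator (cartesian_structure C) A B D))
    /\ (forall A : C,
          triple (fwd (left_unitor M A))
          = iso_triple (left_unitor (cartesian_structure C) A))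
    /\ (forall A : C,
          triple (fwd (right_unitor M A))
          = iso_triple (right_unitor (cartesian_structure C) A))
    /\ (forall A B : C,
          triple (fwd (braiding M A B))
          = iso_triple (braiding (cartesian_structure C) A B))
    /\ (strict (cartesian_structure C) -> strict M).
Proof.
exists (lens_category_on C), (lens_symmetric_monoidal C).
split; first by move=> V; exact: iso_triple_id.
do 6! split=> //.
move=> [[eA strA] [[eL strL] [eR strR]]].
split; [exists eA | split; [exists eL | exists eR]] => *;
  exact: idtohom_lens.
Qed.
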